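(* Let $G$ be an effective, Hausdorff, ample groupoid and let $R$ be a commutative ring with identity. Let $A$ be an $R$-algebra and let $\pi : A_R(G) \to A$ be an $R$-algebra homomorphism. Suppose that $\ker(\pi) \neq \{0\}$. Then there exist a nonempty compact open subset $K \subseteq G^{(0)}$ and an element $r \in R \setminus \{0\}$ such that $\pi(r 1_K) = 0$.
   Context: Groupoids: for a groupoid $G$, $r(\alpha)=\alpha\alpha^{-1}$ and $s(\alpha)=\alpha^{-1}\alpha$ are the range and source maps, their common image is the unit space $G^{(0)} \subseteq G$, and $\alpha\beta$ is defined iff $s(\alpha)=r(\beta)$. A topological groupoid is a groupoid with a topology making composition and inversion continuous. An open bisection is an open set $B \subseteq G$ such that $r|_B$ and $s|_B$ are homeomorphisms onto open subsets of $G^{(0)}$. $G$ is ample if it has a basis of compact open bisections. Let $\operatorname{Iso}(G)=\{\gamma\in G : s(\gamma)=r(\gamma)\}$; $G$ is effective if the interior of $\operatorname{Iso}(G)\setminus G^{(0)}$ is empty. Steinberg algebra: for $G$ Hausdorff and ample, $A_R(G)$ is the $R$-algebra of all locally constant functions $f: G\to R$ with compact support, with pointwise addition and scalar multiplication and product the convolution $(f*g)(\alpha)=\sum_{r(\beta)=r(\alpha)} f(\beta)g(\beta^{-1}\alpha)$ (a sum with finitely many nonzero terms). It need not be unital, and $R$-algebras and their homomorphisms are not assumed unital. For a compact open set $K\subseteq G$ (for instance $K \subseteq G^{(0)}$, which is open in $G$), $1_K \in A_R(G)$ denotes its characteristic function. *)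

(* Defs.v *)
From HB Require Import structures.
From mathcomp Require Import all_boot all_algebra finmap all_classical topology.

Set Implicit Arguments.
Unset Strict Implicit.
Unset Printing Implicit Defensive.

Import GRing.Theory.

Local Open Scope classical_set_scope.
Local Open Scope ring_scope.

(** * Groupoids *)

(* [gmul] is total, but it is the composition of the groupoid only at pairs
   (x, y) with s(x) = r(y), where s(x) = x^-1 x and r(y) = y y^-1; its values
   elsewhere are unconstrained, and every axiom is guarded accordingly. *)
HB.mixin Record isGroupoid G := {
  gmul : G -> G -> G;
  ginv : G -> G;
  ginvK : involutive ginv;
  grng_mul_subproof : forall x y, gmul (ginv x) x = gmul y (ginv y) ->
    gmul (gmul x y) (ginv (gmul x y)) = gmul x (ginv x);
  gsrc_mul_subproof : forall x y, gmul (ginv x) x = gmul y (ginv y) ->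
    gmul (ginv (gmul x y)) (gmul x y) = gmul (ginv y) y;
  gmulA_subproof : forall x y z,
    gmul (ginv x) x = gmul y (ginv y) -> gmul (ginv y) y = gmul z (ginv z) ->
    gmul x (gmul y z) = gmul (gmul x y) z;
  gmul_rng_subproof : forall x, gmul (gmul x (ginv x)) x = x;
  gmul_src_subproof : forall x, gmul x (gmul (ginv x) x) = x
}.

#[short(type="groupoidType")]
HB.structure Definition Groupoid := {G of isGroupoid G}.

Section GroupoidTheory.
Context {G : groupoidType}.
Implicit Types x y z : G.

Definition grng x := gmul x (ginv x).
Definition gsrc x := gmul (ginv x) x.

Definition units : set G := range grng.

Definition composable : set (G * G) := [set p | gsrc p.1 = grng p.2].

Definition isotropy : set G := [set x | gsrc x = grng x].

Lemma grng_mul x y : gsrc x = grng y -> grng (gmul x y) = grng x.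
Proof. exact: grng_mul_subproof. Qed.

Lemma gsrc_mul x y : gsrc x = grng y -> gsrc (gmul x y) = gsrc y.
Proof. exact: gsrc_mul_subproof. Qed.

Lemma gmulA x y z : gsrc x = grng y -> gsrc y = grng z ->
  gmul x (gmul y z) = gmul (gmul x y) z.
Proof. exact: gmulA_subproof. Qed.

Lemma gmul_rng x : gmul (grng x) x = x.
Proof. exact: gmul_rng_subproof. Qed.

Lemma gmul_src x : gmul x (gsrc x) = x.
Proof. exact: gmul_src_subproof. Qed.

Lemma grngV x : grng (ginv x) = gsrc x.
Proof. by rewrite /grng ginvK. Qed.

Lemma gsrcV x : gsrc (ginv x) = grng x.
Proof. by rewrite /gsrc ginvK. Qed.

Lemma grng_rng x : grng (grng x) = grng x.
Proof. by rewrite {2}/grng grng_mul // grngV. Qed.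

Lemma gsrc_rng x : gsrc (grng x) = grng x.
Proof. by rewrite {1}/grng gsrc_mul ?gsrcV // grngV. Qed.

Lemma grng_src x : grng (gsrc x) = gsrc x.
Proof. by rewrite -grngV grng_rng. Qed.

Lemma units_gsrc : range gsrc = units.
Proof.
apply/seteqP; split=> _ [x _ <-]; exists (ginv x) => //; first exact: grngV.
exact: gsrcV.
Qed.

Lemma unitsP x : units x <-> grng x = x.
Proof. by split=> [[y _ <-]|<-]; [exact: grng_rng|exists x]. Qed.

Lemma gmulKV x y : gsrc x = grng y -> gmul (ginv x) (gmul x y) = y.
Proof. by move=> xy; rewrite gmulA ?gsrcV // -/(gsrc x) xy gmul_rng. Qed.

Lemma gmulVK x y : grng x = grng y -> gmul x (gmul (ginv x) y) = y.
Proof. by move=> xy; rewrite -{1}(ginvK x) gmulKV // gsrcV. Qed.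

Lemma grng_mulV x y : grng x = grng y -> grng (gmul (ginv x) y) = gsrc x.
Proof. by move=> xy; rewrite grng_mul ?grngV // gsrcV. Qed.

Lemma gmulVV x y : grng x = grng y -> ginv (gmul (ginv x) y) = gmul (ginv y) x.
Proof.
move=> xy; set z := gmul (ginv x) y.
have sxy : gsrc (ginv x) = grng y by rewrite gsrcV.
have zy : gsrc z = gsrc y by rewrite /z gsrc_mul.
have xz : y = gmul x z by rewrite /z gmulVK.
have rz : grng z = gsrc x by rewrite /z grng_mulV.
rewrite -[LHS]gmul_src gsrcV rz {1}/gsrc gmulA; last 2 first.
- by rewrite gsrcV rz grngV.
- by rewrite gsrcV.
congr (gmul _ x).
rewrite -[RHS]gmul_rng grngV -zy /gsrc -gmulA ?gsrcV// ?grngV//.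
congr (gmul _ _); rewrite /z -gmulA//; last by rewrite grngV.
by rewrite -/(grng y) -xy -gsrcV gmul_src.
Qed.

Lemma gmulV_quot x y z : grng x = grng y -> grng x = grng z ->
  gmul (ginv (gmul (ginv x) y)) (gmul (ginv x) z) = gmul (ginv y) z.
Proof.
move=> xy xz; rewrite gmulVV// -gmulA ?gmulVK//; last by rewrite grng_mulV.
by rewrite gsrcV.
Qed.

End GroupoidTheory.

(** * Topological groupoids *)

HB.mixin Record Groupoid_isTopological G of Topological G & Groupoid G := {
  continuous_gmul : {within @composable G, continuous (fun p => gmul p.1 p.2)};
  continuous_ginv : continuous (@ginv G)
}.

#[short(type="topGroupoidType")]
HB.structure Definition TopGroupoid :=
  {G of Topological G & Groupoid G & Groupoid_isTopological G}.

Definition homeomorphism {T U : topologicalType} (A : set T) (B : set U)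
    (f : T -> U) :=
  [/\ set_bij A B f, {within A, continuous f} &
      exists g, {in A, cancel f g} /\ {within B, continuous g}].

Section Ample.
Context {G : topGroupoidType}.

(* Open subsets of the unit space, for its subspace topology. *)
Definition open_units (U : set G) :=
  exists2 W : set G, open W & U = W `&` units.

Definition open_bisection (B : set G) :=
  [/\ open B,
      open_units (grng @` B) /\ homeomorphism B (grng @` B) grng &
      open_units (gsrc @` B) /\ homeomorphism B (gsrc @` B) gsrc].

Definition ample := basis [set B : set G | compact B /\ open_bisection B].

Definition effective := (@isotropy G `\` units)° = set0.

End Ample.
Arguments ample : clear implicits.
Arguments effective : clear implicits.

HB.mixin Record TopGroupoid_isHausdorffAmple G of TopGroupoid G := {
  groupoid_hausdorff : hausdorff_space G;
  groupoid_ample : ample G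
}.

#[short(type="ampleGroupoidType")]
HB.structure Definition HausdorffAmpleGroupoid :=
  {G of TopGroupoid G & TopGroupoid_isHausdorffAmple G}.

(** * Associative, not necessarily unital, algebras *)

HB.mixin Record Lmodule_isAssocAlgebra (R : comPzRingType) A
    of GRing.Lmodule R A := {
  amul : A -> A -> A;
  amulA : associative amul;
  amulDl : left_distributive amul +%R;
  amulDr : right_distributive amul +%R;
  amulZl : forall (c : R) (x y : A), amul (c *: x) y = c *: amul x y;
  amulZr : forall (c : R) (x y : A), amul x (c *: y) = c *: amul x y
}.

#[short(type="assocAlgType")]
HB.structure Definition AssocAlgebra (R : comPzRingType) :=
  {A of GRing.Lmodule R A & Lmodule_isAssocAlgebra R A}.

(** * Steinberg algebras *)

Definition locally_constant {T : topologicalType} {V : Type} (f : T -> V) :=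
  forall x, \forall y \near x, f y = f x.

Definition support {T : Type} {V : nmodType} (f : T -> V) : set T :=
  [set x | f x != 0].

Definition compact_support {T : topologicalType} {V : nmodType} (f : T -> V) :=
  compact (closure (support f)).

(* The \sum over a set is 0 when infinitely many terms are nonzero; for f in
   the Steinberg algebra the sum is finite by [fiber_support_finite] below. *)
Definition conv {R : comPzRingType} {G : topGroupoidType} (f g : G -> R) : G -> R :=
  fun a => \sum_(b \in [set b | grng b = grng a]) f b * g (gmul (ginv b) a).

Section Supports.
Context {T : topologicalType}.

Lemma locally_constant_closed_support {V : nmodType} (f : T -> V) :
  locally_constant f -> closed (support f).
Proof.
move=> lf x clx; have [y [/= fy /= yx]] := clx _ (lf x).
by rewrite /support /= -yx.
Qed.

Lemma locally_constant_compact_support {V : nmodType} (f : T -> V) :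
  locally_constant f -> compact_support f <-> compact (support f).
Proof.
move=> /locally_constant_closed_support /closure_id sf.
by rewrite /compact_support -sf.
Qed.

Lemma compact_supportS {V : nmodType} (f : T -> V) (K : set T) :
  locally_constant f -> compact K -> support f `<=` K -> compact_support f.
Proof.
move=> lf cK fK; apply/locally_constant_compact_support => //.
exact: subclosed_compact (locally_constant_closed_support lf) cK fK.
Qed.

Lemma locally_constant2 {V1 V2 V : Type} (h : V1 -> V2 -> V)
    (f1 : T -> V1) (f2 : T -> V2) :
  locally_constant f1 -> locally_constant f2 ->
  locally_constant (fun x => h (f1 x) (f2 x)).
Proof.
by move=> l1 l2 x; near=> y; congr h; near: y; [exact: l1|exact: l2].
Unshelve. all: by end_near. Qed.

Lemma compact_discrete_finite (K : set T) : compact K ->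
  (forall x, K x -> exists2 N, nbhs x N & N `&` K `<=` [set x]) ->
  finite_set K.
Proof.
move=> cK dK; apply: contrapT => infK.
pose F : set_system T := [set A | finite_set (K `\` A)].
have FF : ProperFilter F.
  apply: Build_ProperFilter; first by rewrite /F/= setD0.
  split=> [|P Q FP FQ|P Q PQ].
  - by rewrite /F/= setDT.
  - by rewrite /F/= setDIr finite_setU.
  - by apply: sub_finite_set; apply: setDS.
have FK : F K by rewrite /F/= setDv.
have [x [Kx clx]] := cK F FF FK.
have [N xN NK] := dK x Kx.
have [|y [[Ky yx] Ny]] := clx (K `\ x) N _ xN.
  apply: sub_finite_set (finite_set1 x) => y [Ky /not_andP[]//].
  by move=> /contrapT.
by apply: yx; apply: NK.
Qed.

Lemma hausdorff_disjoint_nbhs (S : set T) : hausdorff_space T ->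
  finite_set S -> exists U : T -> set T,
    (forall x, S x -> nbhs x (U x)) /\
    (forall x y z, S x -> S y -> U x z -> U y z -> x = y).
Proof.
rewrite open_hausdorff => hT fS.
have {}hT (p : T * T) : exists AB : set T * set T, p.1 != p.2 ->
    [/\ nbhs p.1 AB.1, nbhs p.2 AB.2 & AB.1 `&` AB.2 = set0].
  have [->|pq] := eqVneq p.1 p.2; first by exists (set0, set0).
  have [[A B] /= [/set_mem xA /set_mem yB] [oA oB /eqP AB]] := hT _ _ pq.
  by exists (A, B) => _; split => //; apply: open_nbhs_nbhs; split.
have [D DP] := choice hT.
pose U x := \bigcap_(y in [set` fset_set S])
  [set z | x != y -> (D (x, y)).1 z /\ (D (y, x)).2 z].
exists U; split=> [x Sx|x y z Sx Sy Ux Uy].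
  apply: filter_bigI => y _; have [->|xy] := eqVneq x y.
    exact: nearW.
  have [Ax _ _] := DP (x, y) xy.
  have yx : y != x by rewrite eq_sym.
  have [_ Bx _] := DP (y, x) yx.
  by apply: filterS (filterI Ax Bx) => z [].
apply/eqP/negP => /negP xy.
have inS u : S u -> u \in fset_set S by move=> ?; rewrite in_fset_set ?mem_set.
have [Az _] := Ux y (inS _ Sy) xy.
have [|_ Bz] := Uy x (inS _ Sx); first by rewrite eq_sym.
have [_ _ AB] := DP (x, y) xy.
by have : set0 z by rewrite -AB.
Qed.

End Supports.

Section TopGroupoidTheory.
Context {G : topGroupoidType}.

Lemma gmul_cvg {T : Type} (F : set_system T) {FF : Filter F} (u v : T -> G)
    (a b : G) :
  u @ F --> a -> v @ F --> b -> gsrc a = grng b ->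
  (\forall t \near F, gsrc (u t) = grng (v t)) ->
  gmul (u t) (v t) @[t --> F] --> gmul a b.
Proof.
move=> ua vb ab uv.
have /subspace_continuousP/(_ (a, b) ab) := @continuous_gmul G.
move=> mulc W /mulc /= W'.
have : F [set t | composable (u t, v t) -> W (gmul (u t) (v t))].
  by apply: (cvg_pair ua vb W').
by apply: filterS2 uv => t tc /(_ tc).
Qed.

Lemma ginv_cvg (a : G) : ginv x @[x --> a] --> ginv a.
Proof. exact: continuous_ginv. Qed.

Lemma continuous_grng : continuous (@grng G).
Proof.
move=> x; apply: gmul_cvg; [exact: cvg_id|exact: ginv_cvg|by rewrite grngV|].
by apply: nearW => y; rewrite grngV.
Qed.

Lemma continuous_gsrc : continuous (@gsrc G).
Proof.
move=> x; apply: gmul_cvg; [exact: ginv_cvg|exact: cvg_id|by rewrite gsrcV|].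
by apply: nearW => y; rewrite gsrcV.
Qed.

Lemma closed_composable : hausdorff_space G -> closed (@composable G).
Proof.
move=> hG [x y] clxy; apply: hG => A B sxA ryB.
have xA : nbhs x (gsrc @^-1` A) by exact: continuous_gsrc.
have yB : nbhs y (grng @^-1` B) by exact: continuous_grng.
have [|[x' y'] [/= xy' [/= Ax By]]] := clxy ((gsrc @^-1` A) `*` (grng @^-1` B)).
  by exists (gsrc @^-1` A, grng @^-1` B).
by exists (gsrc x'); split; [|rewrite xy'].
Qed.

End TopGroupoidTheory.

Section Convolution.
Context {R : comPzRingType} {G : ampleGroupoidType}.
Implicit Types f g h : G -> R.

Let hG : hausdorff_space G := groupoid_hausdorff.

Lemma ample_bisection (x : G) (N : set G) : nbhs x N ->
  exists B, [/\ compact B, open_bisection B, B x & B `<=` N].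
Proof.
have [_ bG] := groupoid_ample (s := G).
by move=> /(bG x)[B [[cB oB] Bx] BN]; exists B.
Qed.

Lemma bisection_grng_inj (B : set G) (x y : G) :
  open_bisection B -> B x -> B y -> grng x = grng y -> x = y.
Proof.
by move=> [_ [_ [[_ injr _] _ _]] _] Bx By; apply: injr; exact: mem_set.
Qed.

Lemma bisection_grng_near (B : set G) (x a : G) :
  open_bisection B -> B x -> grng x = grng a ->
  \forall a' \near a, exists2 c, B c & grng c = grng a'.
Proof.
move=> [_ [[W oW rB] _] _] Bx xa.
have Wa : W (grng a).
  by have [] : (W `&` units) (grng a) by rewrite -rB -xa; exists x.
have : \forall a' \near a, W (grng a').
  by apply: continuous_grng; apply: open_nbhs_nbhs.
apply: filterS => a' Wa'.
have [c Bc ca] : (grng @` B) (grng a') by rewrite rB; split=> //; exists a'.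
by exists c.
Qed.

Definition fiber_support f (a : G) : set G :=
  [set b | grng b = grng a] `&` support f.

Lemma fiber_support_finite f a :
  locally_constant f -> compact_support f -> finite_set (fiber_support f a).
Proof.
move=> lf /(locally_constant_compact_support lf) cf.
have cu : closed [set b : G | grng b = grng a].
  move=> x clx; apply: hG => A B xA aB.
  have [y [/= ya Ay]] := clx _ (continuous_grng xA).
  by exists (grng a); split; [rewrite -ya|exact: nbhs_singleton].
apply: compact_discrete_finite.
  by rewrite /fiber_support setIC; exact: compact_closedI.
move=> x [/= xa fx]; have [B [_ oB Bx _]] := ample_bisection (filterT : nbhs x setT).
exists B; first by case: oB => oB _ _; apply: open_nbhs_nbhs.
by move=> y [By [/= ya fy]]; apply: (bisection_grng_inj oB) => //; rewrite ya.
Qed.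

Lemma convE f g a (P : set G) : finite_set P ->
  fiber_support f a `<=` P -> P `<=` [set b | grng b = grng a] ->
  conv f g a = \sum_(b <- fset_set P) f b * g (gmul (ginv b) a).
Proof.
move=> finP fP Pa; rewrite -fsbig_finite// /conv; apply/esym.
apply: fsbig_widen => // b [/= ba nPb]; apply: contra_notP nPb => fgb.
apply: fP; split=> //; apply/eqP => fb0; apply: fgb.
by rewrite /preimage /= fb0 mul0r.
Qed.

Lemma convE2 f g a (P : set G) : finite_set P ->
  P `<=` [set b | grng b = grng a] ->
  (forall b, grng b = grng a -> f b != 0 -> g (gmul (ginv b) a) != 0 -> P b) ->
  conv f g a = \sum_(b <- fset_set P) f b * g (gmul (ginv b) a).
Proof.
move=> finP Pa fgP; rewrite -fsbig_finite// /conv; apply/esym.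
apply: fsbig_widen => // b [/= ba nPb]; apply: contra_notP nPb => fgb.
apply: fgP => //; apply/eqP => fb0; apply: fgb.
  by rewrite /preimage /= fb0 mul0r.
by rewrite /preimage /= fb0 mulr0.
Qed.

Lemma conv_locally_constant f g :
  locally_constant f -> compact_support f -> locally_constant g ->
  locally_constant (conv f g).
Proof.
move=> lf cf lg a; have finS := fiber_support_finite a lf cf.
set S := fiber_support f a in finS.
have [U [SU UI]] := hausdorff_disjoint_nbhs hG finS.
have gP b : exists N : set G * set G, S b -> [/\ nbhs b N.1, nbhs a N.2 &
    forall c a', N.1 c -> N.2 a' -> grng c = grng a' ->
      g (gmul (ginv c) a') = g (gmul (ginv b) a)].
  have [[/= ba fb]|nSb] := pselect (S b); last by exists (setT, setT).
  pose F := within [set p : G * G | grng p.1 = grng p.2] (nbhs (b, a)).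
  have F1 : p.1 @[p --> F] --> b
    by apply: cvg_trans (cvg_fst (G := nbhs a)); exact/cvg_app/cvg_within.
  have F2 : p.2 @[p --> F] --> a
    by apply: cvg_trans (cvg_snd (F := nbhs b)); exact/cvg_app/cvg_within.
  have : gmul (ginv p.1) p.2 @[p --> F] --> gmul (ginv b) a.
    apply: gmul_cvg => //; first by move=> W /ginv_cvg /F1.
      by rewrite gsrcV.
    by rewrite /F near_withinE; apply: nearW => p /= pE; rewrite gsrcV.
  move=> /(_ _ (lg (gmul (ginv b) a))).
  move=> [[N1 N2] /= [bN aN] N12]; exists (N1, N2) => _; split=> // c a' Nc Na ca.
  exact: (N12 (c, a')).
have {gP}[N NP] := choice gP.
have bisB b : exists B : set G, S b -> [/\ open_bisection B, B b &
    B `<=` U b `&` (N b).1 `&` [set c | f c = f b]].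
  have [Sb|nSb] := pselect (S b); last by exists set0.
  have [bN _ _] := NP b Sb.
  have [B [_ oB Bb BN]] := ample_bisection (filterI (filterI (SU b Sb) bN) (lf b)).
  by exists B.
have {bisB}[B BP] := choice bisB.
pose K := support f `&` ~` \bigcup_(b in S) B b.
have oB : open (\bigcup_(b in S) B b).
  by apply: bigcup_open => b Sb; have [[]] := BP b Sb.
have cK : compact (grng @` K).
  apply: continuous_compact.
    by apply: continuous_subspaceT; exact: continuous_grng.
  apply: compact_closedI; first exact/locally_constant_compact_support.
  exact: open_closedC.
have nearK : \forall a' \near a, ~ (grng @` K) (grng a').
  apply: (@continuous_grng G a (~` (grng @` K))).
  apply: open_nbhs_nbhs; split.
    by apply: closed_openC; exact: compact_closed.
  move=> [c [fc nBc] ca]; apply: nBc; exists c; first by split.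
  by have [] := BP c (conj ca fc).
have nearS : \forall a' \near a, forall b, S b ->
    (N b).2 a' /\ exists2 c, B b c & grng c = grng a'.
  have : nbhs a (\bigcap_(b in [set` fset_set S])
      [set a' | (N b).2 a' /\ exists2 c, B b c & grng c = grng a']).
    apply: filter_bigI => b; rewrite in_fset_set// => /set_mem Sb.
    have [_ aN _] := NP b Sb; have [obB Bb _] := BP b Sb.
    apply: filterI => //; apply: (bisection_grng_near obB Bb).
    by case: Sb.
  by apply: filterS => a' Sa' b Sb; apply: Sa'; rewrite /= in_fset_set ?mem_set.
near=> a'.
have Ka : ~ (grng @` K) (grng a') by near: a'; exact: nearK.
have Sa : forall b, S b ->
    (N b).2 a' /\ exists2 c, B b c & grng c = grng a'.
  by near: a'; exact: nearS.
have hP b : exists c, S b -> B b c /\ grng c = grng a'.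
  have [Sb|nSb] := pselect (S b); last by exists b.
  by have [_ [c]] := Sa b Sb; exists c.
have [s sP] := choice hP.
have finS' := fiber_support_finite a' lf cf.
rewrite (@convE f g a S)//; last by move=> ? [].
rewrite (@convE f g a' (fiber_support f a'))//; last by move=> ? [].
rewrite -!fsbig_finite// (reindex_fsbig s S (fiber_support f a')); last first.
  split.
  - move=> b Sb; have [Bsb sba] := sP b Sb.
    have [_ _ BN] := BP b Sb; have [[_ Nsb] /= fE] := BN _ Bsb.
    by split=> //; rewrite /support /= fE; case: Sb.
  - move=> b b' /set_mem Sb /set_mem Sb' bb'.
    have [Bsb _] := sP b Sb; have [_ _ /(_ _ Bsb)[[Ub _] _]] := BP b Sb.
    have [Bsb' _] := sP b' Sb'; have [_ _ /(_ _ Bsb')[[Ub' _] _]] := BP b' Sb'.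
    by apply: (UI b b' (s b)) => //; rewrite bb'.
  - move=> c [/= ca fc]; have [b Sb Bc] : (\bigcup_(b in S) B b) c.
      by apply: contrapT => nBc; apply: Ka; exists c.
    exists b => //; have [Bsb sba] := sP b Sb; have [obB _ _] := BP b Sb.
    by apply: (bisection_grng_inj obB) => //; rewrite sba.
apply: eq_fsbigr => b /set_mem Sb; have [Bsb sba] := sP b Sb.
have [_ _ BN] := BP b Sb; have [[_ Nsb] /= ->] := BN _ Bsb.
have [_ _ gN] := NP b Sb; rewrite (gN (s b) a')//.
by have [] := Sa b Sb.
Unshelve. all: by end_near. Qed.

Lemma conv_compact_support f g :
  locally_constant f -> compact_support f ->
  locally_constant g -> compact_support g -> compact_support (conv f g).
Proof.
move=> lf cf lg cg; have lfg := conv_locally_constant lf cf lg.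
apply: (@compact_supportS _ _ _
  ((fun p => gmul p.1 p.2) @` ((support f `*` support g) `&` @composable G))).
- exact: lfg.
- apply: continuous_compact.
    by apply: continuous_subspaceW (@continuous_gmul G); exact: subIsetr.
  apply: compact_closedI; last exact: closed_composable.
  by apply: compact_setX; exact/locally_constant_compact_support.
move=> a fga; apply: contrapT => na; move: fga; rewrite /support /=.
move=> /negP; apply; apply/eqP; rewrite /conv fsbig1// => b /= ba.
apply/eqP; apply: contrapT => /negP nz; apply: na.
exists (b, gmul (ginv b) a); rewrite /= ?gmulVK//; split; last first.
  by rewrite /composable /= grng_mulV.
by split; apply: contra nz => /eqP ->; rewrite ?mul0r ?mulr0.
Qed.

Lemma convA f g h :
  locally_constant f -> compact_support f ->
  locally_constant g -> compact_support g ->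
  conv f (conv g h) = conv (conv f g) h.
Proof.
move=> lf cf lg cg; apply/funext => a.
have finC := fiber_support_finite a lf cf; set C := fiber_support f a in finC.
have finD c := fiber_support_finite (gmul (ginv c) a) lg cg.
pose P := \bigcup_(c in C)
  (gmul c @` fiber_support g (gmul (ginv c) a)).
have finP : finite_set P.
  by apply: bigcup_finite => // c _; exact: finite_image.
have Pa : P `<=` [set b | grng b = grng a].
  move=> _ [c [/= ca fc] [d [/= dca gd] <-]].
  by rewrite grng_mul// dca grng_mulV.
have memP c b : C c -> grng b = grng a -> g (gmul (ginv c) b) != 0 -> P b.
  move=> Cc ba gcb; have [/= ca fc] := Cc.
  exists c => //; exists (gmul (ginv c) b); last by rewrite gmulVK// ca ba.
  by split=> //=; rewrite !grng_mulV// ca ba.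
rewrite (@convE f _ a _ finC)//; last by move=> ? [].
rewrite (@convE2 (conv f g) h a P)//; last first.
  move=> b ba fgb _.
  apply: contrapT => nPb; move/negP: fgb; apply; apply/eqP.
  rewrite /conv fsbig1// => c /= cb.
  apply/eqP; apply: contrapT => /negP nz; apply: nPb; apply: (memP c) => //.
    split; first by rewrite /= cb.
    by apply: contra nz => /eqP ->; rewrite mul0r.
  by apply: contra nz => /eqP ->; rewrite mulr0.
transitivity (\sum_(c <- fset_set C) \sum_(b <- fset_set P)
    f c * g (gmul (ginv c) b) * h (gmul (ginv b) a)); last first.
  rewrite exchange_big /= !big_seq; apply: eq_bigr => b.
  rewrite in_fset_set// => /set_mem /Pa /= ba.
  rewrite (@convE f g b C)//.
  - by rewrite mulr_suml.
  - by move=> c [/= cb fc]; split=> //=; rewrite cb.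
  - by move=> c [/= ca fc]; rewrite /= ba.
rewrite !big_seq; apply: eq_bigr => c; rewrite in_fset_set// => /set_mem Cc.
have [/= ca fc] := Cc.
have injP : {in P &, injective (gmul (ginv c))}.
  move=> b b' /set_mem /Pa /= ba /set_mem /Pa /= ba' bb'.
  by rewrite -(@gmulVK _ c b) ?ca ?ba// bb' gmulVK// ca ba'.
rewrite (@convE2 g h _ (gmul (ginv c) @` P)); last 3 first.
- exact: finite_image.
- by move=> _ [b /Pa /= ba <-]; rewrite /= !grng_mulV ?ca.
- move=> d /=; rewrite grng_mulV// => dc gd _; exists (gmul c d).
    exists c => //; exists d => //; split=> //=.
    by rewrite dc grng_mulV.
  by rewrite gmulKV.
rewrite -fsbig_finite; last exact: finite_image.
rewrite fsbig_image// fsbig_finite// mulr_sumr !big_seq; apply: eq_bigr => b.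
rewrite in_fset_set// => /set_mem /Pa /= ba.
by rewrite gmulV_quot ?ca// mulrA.
Qed.

Lemma convDl f1 f2 g :
  locally_constant f1 -> compact_support f1 ->
  locally_constant f2 -> compact_support f2 ->
  conv (f1 \+ f2) g = conv f1 g \+ conv f2 g.
Proof.
move=> l1 c1 l2 c2; apply/funext => a /=.
pose P := fiber_support f1 a `|` fiber_support f2 a.
have finP : finite_set P.
  by rewrite finite_setU; split; exact: fiber_support_finite.
have Pa : P `<=` [set b | grng b = grng a] by move=> b [][].
rewrite !(@convE _ _ _ P)//.
- by rewrite -big_split /=; apply: eq_bigr => b _; rewrite mulrDl.
- by move=> b; right.
- by move=> b; left.
- move=> b [/= ba]; rewrite /support/= => fb.
  have [f1b|f1b] := eqVneq (f1 b) 0; last by left.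
  by right; split=> //; move: fb; rewrite f1b add0r.
Qed.

Lemma convDr f g1 g2 : locally_constant f -> compact_support f ->
  conv f (g1 \+ g2) = conv f g1 \+ conv f g2.
Proof.
move=> lf cf; apply/funext => a /=.
have finC := fiber_support_finite a lf cf.
rewrite !(@convE f _ a _ finC)//; try by move=> ? [].
by rewrite -big_split /=; apply: eq_bigr => b _; rewrite mulrDr.
Qed.

Lemma convZl (k : R) f g : locally_constant f -> compact_support f ->
  conv (fun x => k * f x) g = (fun x => k * conv f g x).
Proof.
move=> lf cf; apply/funext => a /=.
have finC := fiber_support_finite a lf cf.
rewrite (@convE f _ a _ finC)//; last by move=> ? [].
rewrite (@convE (fun x => k * f x) _ a _ finC)//; last by move=> ? [].
  by rewrite mulr_sumr; apply: eq_bigr => b _; rewrite mulrA.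
move=> b [/= ba]; rewrite /support/= => fb; split=> //.
by apply: contra fb => /eqP ->; rewrite mulr0.
Qed.

Lemma convZr (k : R) f g : locally_constant f -> compact_support f ->
  conv f (fun x => k * g x) = (fun x => k * conv f g x).
Proof.
move=> lf cf; apply/funext => a /=.
have finC := fiber_support_finite a lf cf.
rewrite !(@convE f _ a _ finC)//; try by move=> ? [].
by rewrite mulr_sumr; apply: eq_bigr => b _; rewrite mulrCA.
Qed.

End Convolution.

Section SteinbergAlgebra.
Context (R : comPzRingType) (G : ampleGroupoidType).

(* [R^o] is R as a module over itself: it gives [G -> R^o] its pointwise
   R-module structure. *)
Definition steinberg_fun : {pred G -> R^o} :=
  mem [set f : G -> R^o | locally_constant f /\ compact_support f].

Record steinberg := Steinberg {
  steinberg_val :> G -> R^o;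
  steinberg_valP : steinberg_val \in steinberg_fun
}.

HB.instance Definition _ := [isSub for steinberg_val].
HB.instance Definition _ := [Choice of steinberg by <:].

Lemma steinberg_lc (f : steinberg) : locally_constant f.
Proof. by have /set_mem[] := steinberg_valP f. Qed.

Lemma steinberg_cs (f : steinberg) : compact_support f.
Proof. by have /set_mem[] := steinberg_valP f. Qed.

Lemma steinberg_submod_closed : submod_closed steinberg_fun.
Proof.
split=> [|k f g /set_mem[lf cf] /set_mem[lg cg]]; apply/mem_set; split.
- by move=> x; exact: nearW.
- apply: compact_supportS compact0 _; first by move=> x; exact: nearW.
  by move=> x; rewrite /support /= eqxx.
- exact: (locally_constant2 (fun u v : R^o => k *: u + v)).
apply: (@compact_supportS _ _ _ (support f `|` support g)).
- exact: (locally_constant2 (fun u v : R^o => k *: u + v)).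
- by apply: compactU; exact/locally_constant_compact_support.
move=> x; rewrite /support /= => kfg.
have [fx|fx] := eqVneq (f x) 0; last by left.
by right; have : k * (f x : R) + g x != 0 := kfg; rewrite fx mulr0 add0r.
Qed.

HB.instance Definition _ :=
  GRing.isSubmodClosed.Build R (G -> R^o) steinberg_fun steinberg_submod_closed.
HB.instance Definition _ := [SubChoice_isSubLmodule of steinberg by <:].

Lemma steinberg_conv_subproof (f g : steinberg) :
  (conv f g : G -> R^o) \in steinberg_fun.
Proof.
have /set_mem[lf cf] := steinberg_valP f.
have /set_mem[lg cg] := steinberg_valP g; apply/mem_set; split.
  exact: conv_locally_constant.
exact: conv_compact_support.
Qed.

Definition steinberg_mul (f g : steinberg) : steinberg :=
  Steinberg (steinberg_conv_subproof f g).

Fact steinberg_mulA : associative steinberg_mul.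
Proof.
move=> f g h; apply/val_inj/convA.
- exact: steinberg_lc.
- exact: steinberg_cs.
- exact: steinberg_lc.
- exact: steinberg_cs.
Qed.

Fact steinberg_mulDl : left_distributive steinberg_mul +%R.
Proof.
move=> f g h; apply/val_inj/convDl.
- exact: steinberg_lc.
- exact: steinberg_cs.
- exact: steinberg_lc.
- exact: steinberg_cs.
Qed.

Fact steinberg_mulDr : right_distributive steinberg_mul +%R.
Proof.
by move=> f g h; apply/val_inj/convDr; [exact: steinberg_lc|exact: steinberg_cs].
Qed.

Fact steinberg_mulZl (k : R) (f g : steinberg) :
  steinberg_mul (k *: f) g = k *: steinberg_mul f g.
Proof.
by apply/val_inj/convZl; [exact: steinberg_lc|exact: steinberg_cs].
Qed.

Fact steinberg_mulZr (k : R) (f g : steinberg) :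
  steinberg_mul f (k *: g) = k *: steinberg_mul f g.
Proof.
by apply/val_inj/convZr; [exact: steinberg_lc|exact: steinberg_cs].
Qed.

HB.instance Definition _ := Lmodule_isAssocAlgebra.Build R steinberg
  steinberg_mulA steinberg_mulDl steinberg_mulDr steinberg_mulZl steinberg_mulZr.

Lemma steinberg_char_subproof (K : set G) : compact K -> open K ->
  (fun x => (x \in K)%:R : R^o) \in steinberg_fun.
Proof.
move=> cK oK; have lK : locally_constant (fun x => (x \in K)%:R : R^o).
  move=> x; have [Kx|nKx] := pselect (K x).
    have : nbhs x K by exact: open_nbhs_nbhs.
    by apply: filterS => y Ky; rewrite !mem_set.
  have : nbhs x (~` K).
    apply: open_nbhs_nbhs; split=> //; apply: closed_openC.
    exact: compact_closed groupoid_hausdorff cK.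
  by apply: filterS => y nKy; rewrite !memNset.
apply/mem_set; split=> //; apply: (compact_supportS lK cK) => x.
rewrite /support /=; have [/set_mem //|nKx] := boolP (x \in K).
by rewrite eqxx.
Qed.

Definition steinberg_char (K : set G) (cK : compact K) (oK : open K) : steinberg :=
  Steinberg (steinberg_char_subproof cK oK).

End SteinbergAlgebra.
Arguments steinberg_char R {G K}.

(* Main.v *)
(** Let f be a nonzero element of the kernel.  Multiplying f on the left by the
    characteristic function of a bisection through the inverse of a point where
    f does not vanish moves that point into the unit space, so f(u) <> 0 for
    some unit u.  The support of f off the unit space is compact and covered by
    bisections missing the unit space; as G is effective, each of them contains
    arrows whose range and source differ, and one can shrink any open set of
    units to one across which the bisection has no arrow.  A compact open K
    obtained in this way inside the set of units where f = f(u) satisfies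
    1_K * f * 1_K = f(u) 1_K, and the left-hand side is in the kernel. *)

Require Import Defs.
From HB Require Import structures.
From mathcomp Require Import all_boot all_algebra finmap all_classical topology.

Set Implicit Arguments.
Unset Strict Implicit.
Unset Printing Implicit Defensive.

Import GRing.Theory.

Local Open Scope classical_set_scope.
Local Open Scope ring_scope.

Section AssocAlgebraTheory.
Context {R : comPzRingType} {A : assocAlgType R}.
Implicit Types x : A.

Lemma amul0l x : amul 0 x = 0.
Proof. by rewrite -(scale0r (0 : A)) amulZl !scale0r. Qed.

Lemma amul0r x : amul x 0 = 0.
Proof. by rewrite -(scale0r (0 : A)) amulZr !scale0r. Qed.

End AssocAlgebraTheory.

Section UnitSpace.
Context {G : ampleGroupoidType}.
Implicit Types (x : G) (B U V S K : set G).

(** If [x] is a unit and [B] a bisection around it, each [y] near [x] has both [y] and [grng y] in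
    [B]; these share their range, so they coincide. *)
Lemma open_units_space : open (@units G).
Proof.
rewrite openE => x ux; have [B [_ oB Bx _]] := ample_bisection (@filterT _ (nbhs x) _).
have rB : nbhs x (@grng G @^-1` B).
  apply: continuous_grng; rewrite (unitsP x).1//.
  by case: oB => oB _ _; exact: open_nbhs_nbhs.
have nB : nbhs x B by case: oB => oB _ _; exact: open_nbhs_nbhs.
apply: filterS (filterI nB rB) => y [By /= Bry]; apply/unitsP.
by apply: (bisection_grng_inj oB) => //; rewrite grng_rng.
Qed.

(** Units are the fixed points of the continuous map [grng], and [G] is Hausdorff. *)
Lemma closed_units_space : closed (@units G).
Proof.
move=> x clx; apply/unitsP; apply: groupoid_hausdorff => P Q rP xQ.
have xP : nbhs x (grng @^-1` P) by exact: continuous_grng.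
have [y [uy [/= Py Qy]]] := clx _ (filterI xP xQ).
by exists y; split=> //; rewrite -((unitsP y).1 uy).
Qed.

Lemma open_bisection_grng_image B : open_bisection B -> open (grng @` B).
Proof.
by move=> [_ [[W oW ->] _] _]; apply: openI oW _; exact: open_units_space.
Qed.

Definition no_arrow S V := forall x, S x -> V (grng x) -> V (gsrc x) -> False.

(** A smallness condition akin to nowhere density: it passes to subsets and finite unions, hence can
    be checked locally on a compact set. *)
Definition avoidable S := forall U, open U -> U !=set0 ->
  exists V, [/\ open V, V !=set0, V `<=` U & no_arrow S V].

Lemma avoidable_sub S S' : S `<=` S' -> avoidable S' -> avoidable S.
Proof.
move=> SS' aS' U oU U0; have [V [oV V0 VU nV]] := aS' U oU U0.
by exists V; split=> // x /SS'; exact: nV.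
Qed.

Lemma avoidableU S S' : avoidable S -> avoidable S' -> avoidable (S `|` S').
Proof.
move=> aS aS' U oU U0; have [V [oV V0 VU nV]] := aS U oU U0.
have [W [oW W0 WV nW]] := aS' V oV V0.
exists W; split=> //; first exact: subset_trans WV VU.
by move=> x [Sx /WV ? /WV|]; [exact: nV|exact: nW].
Qed.

Lemma avoidable_bisection B : effective G -> open_bisection B ->
  B `&` units = set0 -> avoidable B.
Proof.
move=> eG oB Bu U oU U0.
pose BU := B `&` (grng @^-1` U `&` gsrc @^-1` U).
have oBU : open BU.
  apply: openI; first by case: oB.
  by apply: openI; apply: open_comp => // x _;
    [exact: continuous_grng|exact: continuous_gsrc].
have [[x BUx xI]|allI] := pselect (exists2 x, BU x & gsrc x <> grng x); last first.
  (* Every arrow of [BU] is isotropic here, so [BU], being open and free of units, is empty by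
     effectiveness: [U] itself serves. *)
  exists U; split=> // x Bx Urx Usx.
  have : (@isotropy G `\` units)° x.
    apply: (@filterS _ _ _ BU); last exact: open_nbhs_nbhs.
    move=> y BUy; split; first by apply: contrapT => yI; apply: allI; exists y.
    by move=> uy; have : set0 y by rewrite -Bu; case: BUy.
  by rewrite eG.
have := @groupoid_hausdorff G; rewrite open_hausdorff.
move=> /(_ (grng x) (gsrc x))[|[P Q]]; first by apply/eqP => /esym.
move=> /= [/set_mem rP /set_mem sQ] [oP oQ /eqP PQ0].
have nx : nbhs x (BU `&` (grng @^-1` P `&` gsrc @^-1` Q)).
  apply: filterI; first exact: open_nbhs_nbhs.
  by apply: filterI; [apply: continuous_grng|apply: continuous_gsrc];
    apply: open_nbhs_nbhs.
have [C [_ oC Cx CB]] := ample_bisection nx.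
exists (grng @` C); split.
- exact: open_bisection_grng_image.
- by exists (grng x), x.
- by move=> _ [y /CB[[_ [Uy _]] _] <-].
(* [B] has at most one arrow with a given range, so [y] lies in [C] and its source in [Q]; yet all
   ranges of [C] lie in [P]. *)
move=> y By [z Cz zy] [w Cw wy].
have [[Bz _] [_ Qz]] := CB _ Cz; have [_ [Pw _]] := CB _ Cw.
have yz : z = y by exact: (bisection_grng_inj oB).
have : (P `&` Q) (gsrc y) by split; [rewrite -wy|rewrite -yz].
by rewrite PQ0.
Qed.

(** Compactness in filter form: were [K] not avoidable, the sets with avoidable complement in [K]
    would form a proper filter, and a cluster point in [K] would have a bisection neighbourhood
    whose complement is in that filter. *)
Lemma avoidable_compact K : effective G -> compact K -> K `&` units = set0 ->
  avoidable K.
Proof.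
move=> eG cK Ku; apply: contrapT => naK.
pose F : set_system G := [set S | avoidable (K `\` S)].
have FF : ProperFilter F.
  apply: Build_ProperFilter; first by rewrite /F/= setD0.
  split=> [|P Q FP FQ|P Q PQ].
  - by rewrite /F/= setDT => U oU U0; exists U; split.
  - by rewrite /F/= setDIr; exact: avoidableU.
  - by apply: avoidable_sub; exact: setDS.
have FK : F K by rewrite /F/= setDv => U oU U0; exists U; split.
have [x [Kx clx]] := cK F FF FK.
have nux : nbhs x (~` @units G).
  apply: open_nbhs_nbhs; split; first exact: closed_openC closed_units_space.
  by move=> ux; have : set0 x by rewrite -Ku.
have [B [_ oB Bx Bu]] := ample_bisection nux.
have [||y []//] := clx (~` B) B.
  rewrite /F/= setDE setCK; apply: (@avoidable_sub _ B); first exact: subIsetr.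
  by apply: avoidable_bisection => //; apply/disjoints_subset.
by case: oB => oB _ _; exact: open_nbhs_nbhs.
Qed.

End UnitSpace.

Section CharacteristicFunctions.
Context {R : comPzRingType} {G : ampleGroupoidType}.
Implicit Types (f : G -> R) (a b : G) (B K : set G).

Lemma conv1 f g a b : grng b = grng a ->
  (forall c, grng c = grng a -> f c != 0 -> g (gmul (ginv c) a) != 0 -> c = b) ->
  conv f g a = f b * g (gmul (ginv b) a).
Proof.
move=> ba cb; rewrite (@convE2 _ _ _ _ _ [set b])//.
- by rewrite fset_set1 big_seq_fset1.
- by move=> _ ->.
Qed.

Lemma indicator_neq0 (S : set G) a : (a \in S)%:R != 0 :> R -> S a.
Proof. by have [/set_mem|] := boolP (a \in S); rewrite ?eqxx. Qed.

(** The only factorisation of [a] starting in [B] uses [b], so the indicator of [B] acts as a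
    translation. *)
Lemma conv_bisectionl B f a b : open_bisection B -> B b -> grng b = grng a ->
  conv (fun x => (x \in B)%:R) f a = f (gmul (ginv b) a).
Proof.
move=> oB Bb ba; rewrite (@conv1 _ _ _ b)//; first by rewrite mem_set// mul1r.
move=> c ca /indicator_neq0 Bc _.
by apply: (bisection_grng_inj oB) => //; rewrite ba.
Qed.

Lemma conv_unitsl K f a : K `<=` units ->
  conv (fun x => (x \in K)%:R) f a = (grng a \in K)%:R * f a.
Proof.
move=> Ku; rewrite (@conv1 _ _ _ (grng a)); last 2 first.
- exact: grng_rng.
- by move=> c <- /indicator_neq0 /Ku /unitsP.
by rewrite -{3}(gmul_rng a) gmulKV// gsrc_rng.
Qed.

Lemma conv_unitsr K f a : K `<=` units ->
  conv f (fun x => (x \in K)%:R) a = f a * (gsrc a \in K)%:R.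
Proof.
move=> Ku; rewrite (@conv1 _ _ _ a)// => c ca _ /indicator_neq0 /Ku /unitsP.
by rewrite grng_mulV// => sc; rewrite -(gmulVK ca) -sc gmul_src.
Qed.

End CharacteristicFunctions.

Theorem theorem3p2 (G : ampleGroupoidType) (R : comPzRingType)
    (A : assocAlgType R) (pi : {linear steinberg R G -> A}) :
  effective G ->
  {morph pi : f g / amul f g >-> amul f g} ->
  [set f | pi f = 0] <> [set 0] ->
  exists (K : set G) (cK : compact K) (oK : open K) (r : R),
    [/\ K !=set0, K `<=` units, r != 0 & pi (r *: steinberg_char R cK oK) = 0].
Proof.
move=> eG piM kerN0.
have [f pif [u uu fu]] : exists2 f : steinberg R G, pi f = 0 &
    exists2 u, units u & f u != 0.
  have [f pif f0] : exists2 f, pi f = 0 & f <> 0.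
    apply: contrapT => nex; apply: kerN0; apply/seteqP; split=> [f /= pif|_ ->].
      by apply: contrapT => f0; apply: nex; exists f.
    exact: raddf0.
  have [x fx] : exists x, f x <> 0.
    apply: contrapT => nx; apply: f0; apply/val_inj/funext => x.
    by apply: contrapT => fx; apply: nx; exists x.
  (* With [B] through the inverse of [x], the product takes the value [f x] at the unit [gsrc x]. *)
  have [B [cB oB Bx _]] := ample_bisection (@filterT _ (nbhs (ginv x)) _).
  have [opB _ _] := oB.
  exists (amul (steinberg_char R cB opB) f); first by rewrite piM pif amul0r.
  exists (gsrc x); first by apply/unitsP; exact: grng_src.
  have -> : amul (steinberg_char R cB opB) f (gsrc x) = f x.
    rewrite [LHS](@conv_bisectionl R G B f (gsrc x) (ginv x))//.
      by rewrite ginvK gmul_src.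
    by rewrite grngV grng_src.
  exact/eqP.
have [V [oV [v Vv] Vf nV]] : exists V, [/\ open V, V !=set0,
    V `<=` units `&` [set x | f x = f u] & no_arrow (Defs.support f `\` units) V].
  (* The units being open, the support stays compact without them. *)
  have cS : compact (Defs.support f `\` units).
    apply: compact_closedI; last exact: open_closedC open_units_space.
    apply/locally_constant_compact_support; first exact: steinberg_lc.
    exact: steinberg_cs.
  apply: (avoidable_compact eG cS); first by rewrite setDE -setIA setICl setI0.
  - apply: openI; first exact: open_units_space.
    rewrite openE => x /= fx; have := @steinberg_lc _ _ f x.
    by apply: filterS => y /= ->.
  - by exists u.
have [K [cK [oK _ _] Kv KV]] := ample_bisection (open_nbhs_nbhs (conj oV Vv)).
have Ku : K `<=` units by move=> x /KV /Vf [].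
exists K, cK, oK, (f u); split=> //; first by exists v.
set chi := steinberg_char R cK oK.
suff <- : amul (amul chi f) chi = (f u : R) *: chi.
  by rewrite !piM pif amul0r amul0l.
apply/val_inj/funext => x.
rewrite [LHS](@conv_unitsr R G K)// [X in X * _](@conv_unitsl R G K)//.
transitivity ((f u : R) * (x \in K)%:R); last by [].
have [/set_mem Kx|nKx] := boolP (x \in K).
  have rx := (unitsP x).1 (Ku _ Kx); have sx : gsrc x = x by rewrite -rx gsrc_rng.
  rewrite rx sx mem_set// mul1r.
  by have [_ /= ->] := Vf _ (KV _ Kx).
rewrite mulr0; have [fx|fx] := eqVneq (f x) 0; first by rewrite fx mulr0 mul0r.
have [/set_mem Krx|] := boolP (grng x \in K); last by rewrite !mul0r.
have [/set_mem Ksx|] := boolP (gsrc x \in K); last by rewrite mulr0.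
(* An [x] outside [K] with both ends in [K] is no unit, since a unit is its own range. *)
exfalso; apply: (nV x) => //; [split=> // /unitsP rx|exact: KV|exact: KV].
by move/negP: nKx; apply; rewrite -rx; exact: mem_set.
Qed.
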